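(* Let $\Omega\subset\mathbb{R}^2$ be a domain, let $p,q$ be complex valued functions on $\Omega$ with $p\in C^2(\Omega)$, $p\neq0$ in $\Omega$, let $u_0$ be a nonvanishing solution in $\Omega$ of $$(\operatorname{div}p\operatorname{grad}+q)u=0, \qquad (\ast)$$ and set $f=p^{1/2}u_0$. Let $W=W_1+W_2k$ (with $W_1,W_2$ complex valued) be a solution in $\Omega$ of the bicomplex Vekua equation $W_{\overline z}=\frac{f_{\overline z}}{f}\overline W$. Then $u=p^{-1/2}W_1$ is a solution of $(\ast)$ in $\Omega$, and $v=p^{1/2}W_2$ is a solution of the equation $$\left(\operatorname{div}\frac1p\operatorname{grad}+q_1\right)v=0\qquad\text{in }\Omega,$$ where $$q_1=-\frac1p\left(\frac qp+2\left\langle\frac{\nabla p}{p},\frac{\nabla u_0}{u_0}\right\rangle+2\left(\frac{\nabla u_0}{u_0}\right)^2\right).$$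
   Context: Bicomplex numbers are elements $Q_1+Q_2k$ with $Q_1,Q_2\in\mathbb{C}=\{a+ib:a,b\in\mathbb{R}\}$, where $i^2=k^2=-1$ and $ik=ki$ (a commutative algebra). Conjugation: $\overline{Q_1+Q_2k}=Q_1-Q_2k$ (it does not conjugate $i$). With real variables $x,y$ and $z=x+ky$, $\partial_{\overline z}=\frac12(\partial_x+k\partial_y)$, $W_{\overline z}=\partial_{\overline z}W$, $f_{\overline z}=\partial_{\overline z}f$. The operator $\operatorname{div}p\operatorname{grad}+q$ acts by $\varphi\mapsto\operatorname{div}(p\operatorname{grad}\varphi)+q\varphi$, and similarly with $1/p$, $q_1$. For complex vectors $a=(a_1,a_2)$, $b=(b_1,b_2)$: $\langle a,b\rangle=a_1b_1+a_2b_2$ (bilinear) and $a^2=\langle a,a\rangle$. $p^{1/2}$ denotes one fixed twice continuously differentiable function on $\Omega$ whose square is $p$, and $p^{-1/2}=1/p^{1/2}$. Solutions are understood in the classical sense, as twice continuously differentiable functions. *)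

(* Defs.v *)
From Stdlib Require Import Reals.
From Coquelicot Require Import Coquelicot.

Open Scope C_scope.

(* A function on a domain Omega of the plane is a total function on R2; only
   its values on Omega matter, since Omega is open and all the operators below
   are local. *)
Definition R2 : Type := (R * R)%type.

Definition connected (U : R2 -> Prop) : Prop :=
  forall A B : R2 -> Prop,
    open A -> open B ->
    (forall z, U z -> A z \/ B z) ->
    (exists z, U z /\ A z) ->
    (exists z, U z /\ B z) ->
    exists z, U z /\ A z /\ B z.

Definition is_domain (U : R2 -> Prop) : Prop :=
  open U /\ connected U /\ exists z, U z.

(* Partial derivatives with respect to the real variables x and y.  They are
   total, hence meaningful only where the function is partially
   differentiable; differentiability is recorded by Ck_on. *)
Definition ex_dx (u : R2 -> C) (z : R2) : Prop :=
  ex_derive (K := R_AbsRing) (V := C_R_NormedModule)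
    (fun t : R => u (t, snd z)) (fst z).

Definition ex_dy (u : R2 -> C) (z : R2) : Prop :=
  ex_derive (K := R_AbsRing) (V := C_R_NormedModule)
    (fun t : R => u (fst z, t)) (snd z).

Definition dx (u : R2 -> C) (z : R2) : C :=
  (Derive (fun t : R => Re (u (t, snd z))) (fst z),
   Derive (fun t : R => Im (u (t, snd z))) (fst z)).

Definition dy (u : R2 -> C) (z : R2) : C :=
  (Derive (fun t : R => Re (u (fst z, t))) (snd z),
   Derive (fun t : R => Im (u (fst z, t))) (snd z)).

Fixpoint Ck_on (n : nat) (U : R2 -> Prop) (u : R2 -> C) : Prop :=
  (forall z, U z -> continuous u z) /\
  match n with
  | O => True
  | S m =>
      (forall z, U z -> ex_dx u z /\ ex_dy u z) /\
      Ck_on m U (dx u) /\ Ck_on m U (dy u)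
  end.

(* Vectors of C^2 and the bilinear (not sesquilinear) product. *)
Definition Cvec : Type := (C * C)%type.

Definition vscal (c : C) (a : Cvec) : Cvec := (c * fst a, c * snd a).

Definition dot (a b : Cvec) : C := fst a * fst b + snd a * snd b.

Definition grad (u : R2 -> C) (z : R2) : Cvec := (dx u z, dy u z).

Definition div (F : R2 -> Cvec) (z : R2) : C :=
  dx (fun w => fst (F w)) z + dy (fun w => snd (F w)) z.

(* The operator div p grad + q. *)
Definition div_grad_op (p q : R2 -> C) (u : R2 -> C) (z : R2) : C :=
  div (fun w => vscal (p w) (grad u w)) z + q z * u z.

Definition is_solution (U : R2 -> Prop) (p q : R2 -> C) (u : R2 -> C) : Prop :=
  Ck_on 2 U u /\ forall z, U z -> div_grad_op p q u z = 0.

(* Bicomplex numbers Q1 + Q2 k, with k^2 = -1 and i k = k i. *)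
Record bicomplex : Type := mkB { sc : C; vec : C }.

Definition B_of_C (c : C) : bicomplex := mkB c 0.

Definition Bk : bicomplex := mkB 0 1.

Definition Bplus (a b : bicomplex) : bicomplex :=
  mkB (sc a + sc b) (vec a + vec b).

Definition Bmult (a b : bicomplex) : bicomplex :=
  mkB (sc a * sc b - vec a * vec b) (sc a * vec b + vec a * sc b).

Definition Bconj (a : bicomplex) : bicomplex := mkB (sc a) (- vec a).

Definition Bdx (W : R2 -> bicomplex) (z : R2) : bicomplex :=
  mkB (dx (fun w => sc (W w)) z) (dx (fun w => vec (W w)) z).

Definition Bdy (W : R2 -> bicomplex) (z : R2) : bicomplex :=
  mkB (dy (fun w => sc (W w)) z) (dy (fun w => vec (W w)) z).

Definition Dzbar (W : R2 -> bicomplex) (z : R2) : bicomplex :=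
  Bmult (B_of_C (1 / 2)) (Bplus (Bdx W z) (Bmult Bk (Bdy W z))).

(* W_zbar = (f_zbar / f) conj(W), for a complex valued, nonvanishing f. *)
Definition is_vekua_solution (U : R2 -> Prop) (f : R2 -> C)
    (W : R2 -> bicomplex) : Prop :=
  Ck_on 2 U (fun z => sc (W z)) /\
  Ck_on 2 U (fun z => vec (W z)) /\
  forall z, U z ->
    Dzbar W z =
    Bmult (Bmult (Dzbar (fun w => B_of_C (f w)) z) (B_of_C (/ f z)))
          (Bconj (W z)).

Definition q1 (p q u0 : R2 -> C) (z : R2) : C :=
  let P := vscal (/ p z) (grad p z) in
  let V := vscal (/ u0 z) (grad u0 z) in
  - (1 / p z) * (q z / p z + 2 * dot P V + 2 * dot V V).

(* Main.v *)
Require Import Defs.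
From Stdlib Require Import Reals.
From Coquelicot Require Import Coquelicot.
Local Open Scope C_scope.

(** Write [f = s * u0], [phi = W1 / f] and [psi = f * W2].  Separating the two
    complex components, the Vekua equation becomes the first order system
      [f^2 phi_x = psi_y],  [f^2 phi_y = - psi_x]
    ([vekua_system]).  Since mixed second derivatives commute, it follows that
    [div (f^2 grad phi) = 0] and [div (f^-2 grad psi) = 0]
    ([div_grad_stream]).

    These two equations are transformed by the identity
      [w div (a grad (w phi)) = phi w div (a grad w) + div (a w^2 grad phi)]
    ([div_grad_mult]).  As [f^2 = p u0^2], the choice [a = p], [w = u0] shows
    that [u0 phi = W1 / s] satisfies the equation of [u0], while the choice
    [a = 1 / p], [w = 1 / u0] shows that [psi / u0 = s W2] satisfies the
    equation [div (1/p) grad + Q] that [1 / u0] satisfies.  Its potential is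
    [Q = - u0 div ((1/p) grad (1 / u0))], which [div_grad_inv] identifies
    with [q1].

    The remaining lemmas supply the differential calculus of complex valued
    functions of two real variables, notably the stability of the classes [Ck]
    under products and inverses, which yields the regularity of the two
    solutions. *)

(** * Complex valued functions of one real variable *)

(** A complex valued function of a real variable is differentiable exactly when
    its real and imaginary parts are. *)
Lemma is_derive_C_iff (g : R -> C) (t : R) (l : C) :
  is_derive (K := R_AbsRing) (V := C_R_NormedModule) g t l <->
  is_derive (fun r => Re (g r)) t (Re l) /\
  is_derive (fun r => Im (g r)) t (Im l).
Proof.
  split.
  - intros [_ H]; split; (split; [apply is_linear_scal_l|]).
    + intros y Hy.
      exact (proj2 (filterdiff_comp' (U := R_NormedModule) (V := C_R_NormedModule)
        (W := R_NormedModule) g fst t (fun y => scal y l) fst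
        (conj (is_linear_scal_l _) H)
        (filterdiff_linear _ is_linear_fst)) y Hy).
    + intros y Hy.
      exact (proj2 (filterdiff_comp' (U := R_NormedModule) (V := C_R_NormedModule)
        (W := R_NormedModule) g snd t (fun y => scal y l) snd
        (conj (is_linear_scal_l _) H)
        (filterdiff_linear _ is_linear_snd)) y Hy).
  - intros [H1 H2].
    (* g = Re g * (1, 0) + Im g * (0, 1) over the reals *)
    assert (E : forall c : C, c = plus (G := C_R_NormedModule)
      (scal (V := C_R_NormedModule) (Re c) (1, 0)%R)
      (scal (V := C_R_NormedModule) (Im c) (0, 1)%R)).
    { intros [a b]; unfold plus, scal; simpl; unfold prod_plus, prod_scal; simpl.
      unfold plus, scal; simpl; unfold mult; simpl; f_equal; ring. }
    rewrite (E l).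
    apply is_derive_ext with (f := fun r => plus (G := C_R_NormedModule)
      (scal (V := C_R_NormedModule) (Re (g r)) (1, 0)%R)
      (scal (V := C_R_NormedModule) (Im (g r)) (0, 1)%R)).
    { intros r; symmetry; apply E. }
    apply (is_derive_plus (K := R_AbsRing) (V := C_R_NormedModule)).
    + now apply (is_derive_scal_l (K := R_AbsRing) (V := C_R_NormedModule)).
    + now apply (is_derive_scal_l (K := R_AbsRing) (V := C_R_NormedModule)).
Qed.

(** The next two lemmas are the real and imaginary parts of the product rule in
    C; [is_derive_quot_sqr] serves both parts of the inverse rule, where the
    numerator [n] is [a] or [- b]. *)
Lemma is_derive_mult_sub (a b c d : R -> R) (t a' b' c' d' : R) :
  is_derive a t a' -> is_derive b t b' ->
  is_derive c t c' -> is_derive d t d' ->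
  is_derive (fun r => a r * c r - b r * d r)%R t
    (a' * c t + a t * c' - (b' * d t + b t * d'))%R.
Proof.
  intros Ha Hb Hc Hd.
  auto_derive; [repeat split; eexists; eassumption|].
  pose proof (is_derive_unique (fun x : R => a x) _ _ Ha) as ->.
  pose proof (is_derive_unique (fun x : R => b x) _ _ Hb) as ->.
  pose proof (is_derive_unique (fun x : R => c x) _ _ Hc) as ->.
  pose proof (is_derive_unique (fun x : R => d x) _ _ Hd) as ->.
  ring.
Qed.

Lemma is_derive_mult_add (a b c d : R -> R) (t a' b' c' d' : R) :
  is_derive a t a' -> is_derive b t b' ->
  is_derive c t c' -> is_derive d t d' ->
  is_derive (fun r => a r * d r + b r * c r)%R t
    (a' * d t + a t * d' + (b' * c t + b t * c'))%R.
Proof.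
  intros Ha Hb Hc Hd.
  auto_derive; [repeat split; eexists; eassumption|].
  pose proof (is_derive_unique (fun x : R => a x) _ _ Ha) as ->.
  pose proof (is_derive_unique (fun x : R => b x) _ _ Hb) as ->.
  pose proof (is_derive_unique (fun x : R => c x) _ _ Hc) as ->.
  pose proof (is_derive_unique (fun x : R => d x) _ _ Hd) as ->.
  ring.
Qed.

Lemma is_derive_quot_sqr (a b n : R -> R) (t a' b' n' : R) :
  (a t ^ 2 + b t ^ 2 <> 0)%R ->
  is_derive a t a' -> is_derive b t b' -> is_derive n t n' ->
  is_derive (fun r => n r / (a r ^ 2 + b r ^ 2))%R t
    (n' / (a t ^ 2 + b t ^ 2)
     - n t * (2 * a t * a' + 2 * b t * b') / (a t ^ 2 + b t ^ 2) ^ 2)%R.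
Proof.
  intros H Ha Hb Hn.
  auto_derive; [repeat split; try (eexists; eassumption); exact H|].
  pose proof (is_derive_unique (fun x : R => a x) _ _ Ha) as ->.
  pose proof (is_derive_unique (fun x : R => b x) _ _ Hb) as ->.
  pose proof (is_derive_unique (fun x : R => n x) _ _ Hn) as ->.
  field; exact H.
Qed.

Lemma is_derive_Cmult (g h : R -> C) (t : R) (g' h' : C) :
  is_derive (K := R_AbsRing) (V := C_R_NormedModule) g t g' ->
  is_derive (K := R_AbsRing) (V := C_R_NormedModule) h t h' ->
  is_derive (K := R_AbsRing) (V := C_R_NormedModule)
    (fun r => g r * h r) t (g' * h t + g t * h').
Proof.
  rewrite !is_derive_C_iff; intros [g1 g2] [h1 h2].
  split.
  - evar_last.
    + exact (is_derive_mult_sub _ _ _ _ t _ _ _ _ g1 g2 h1 h2).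
    + unfold Re, Im; simpl; ring.
  - evar_last.
    + exact (is_derive_mult_add _ _ _ _ t _ _ _ _ g1 g2 h1 h2).
    + unfold Re, Im; simpl; ring.
Qed.

Lemma Cnorm2_neq_0 (c : C) : c <> 0 -> (Re c ^ 2 + Im c ^ 2 <> 0)%R.
Proof.
  intros H E; apply H; simpl in E; rewrite !Rmult_1_r in E.
  destruct (Rplus_sqr_eq_0 _ _ E) as [E1 E2].
  destruct c as [a b]; simpl in *; now subst.
Qed.

Lemma is_derive_Cinv (g : R -> C) (t : R) (g' : C) :
  g t <> 0 ->
  is_derive (K := R_AbsRing) (V := C_R_NormedModule) g t g' ->
  is_derive (K := R_AbsRing) (V := C_R_NormedModule)
    (fun r => / g r) t (- g' * (/ g t * / g t)).
Proof.
  intros H; apply Cnorm2_neq_0 in H.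
  rewrite !is_derive_C_iff; intros [g1 g2].
  split.
  - evar_last.
    + exact (is_derive_quot_sqr _ _ _ t _ _ _ H g1 g2 g1).
    + unfold Re, Im in *; simpl; field.
      simpl in H; now rewrite !Rmult_1_r in H.
  - evar_last.
    + exact (is_derive_quot_sqr _ _ _ t _ _ _ H g1 g2 (is_derive_opp _ _ _ g2)).
    + unfold Re, Im, opp in *; simpl; field.
      simpl in H; now rewrite !Rmult_1_r in H.
Qed.

(** * Partial derivatives in a direction *)

(** The line through [z] in direction [d], parametrized by the coordinate that
    varies.  A boolean encodes the direction, [true] for x and [false] for y, so
    that the two partial derivatives are treated at once. *)
Definition line (d : bool) (z : R2) (t : R) : R2 :=
  if d then (t, snd z) else (fst z, t).

(** The value of the parameter at which [line d z] passes through [z]. *)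
Definition coord (d : bool) (z : R2) : R := if d then fst z else snd z.

(** The partial derivative in direction [d]; it is convertible to [dx] or [dy]
    once [d] is known. *)
Definition pd (d : bool) : (R2 -> C) -> R2 -> C := if d then dx else dy.

(** [l] is the partial derivative of [u] at [z] in direction [d], existence
    included. *)
Definition is_pd (d : bool) (u : R2 -> C) (z : R2) (l : C) : Prop :=
  is_derive (K := R_AbsRing) (V := C_R_NormedModule)
    (fun t => u (line d z t)) (coord d z) l.

Lemma line_coord (d : bool) (z : R2) : line d z (coord d z) = z.
Proof. now destruct d, z. Qed.

Lemma is_pd_unique (d : bool) (u : R2 -> C) (z : R2) (l : C) :
  is_pd d u z l -> pd d u z = l.
Proof.
  intros H; apply is_derive_C_iff in H; destruct H as [H1 H2].
  apply is_derive_unique in H1, H2.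
  destruct l as [l1 l2]; simpl in H1, H2.
  destruct d; simpl; unfold dx, dy; f_equal; assumption.
Qed.

Lemma is_pd_pd (d : bool) (u : R2 -> C) (z : R2) :
  (exists l, is_pd d u z l) -> is_pd d u z (pd d u z).
Proof. intros [l H]; now rewrite (is_pd_unique _ _ _ _ H). Qed.

(** Partial derivatives at a point of an open set depend only on the values in
    that set; this is needed because the total functions agree only there. *)
Lemma is_pd_ext (d : bool) (U : R2 -> Prop) (u v : R2 -> C) (z : R2) (l : C) :
  open U -> U z -> (forall w, U w -> u w = v w) ->
  is_pd d u z l -> is_pd d v z l.
Proof.
  intros HU Hz E; apply is_derive_ext_loc.
  destruct (HU z Hz) as [eps Heps].
  exists eps; intros t Ht; apply E, Heps.
  destruct d; split; simpl; try exact Ht; apply ball_center.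
Qed.

Lemma pd_ext (d : bool) (U : R2 -> Prop) (u v : R2 -> C) (z : R2) :
  open U -> U z -> (forall w, U w -> u w = v w) -> pd d u z = pd d v z.
Proof.
  intros HU Hz E.
  destruct (HU z Hz) as [eps Heps].
  destruct d; simpl; unfold dx, dy; f_equal; apply Derive_ext_loc;
    exists eps; intros t Ht; f_equal; apply E, Heps;
    split; simpl; try exact Ht; apply ball_center.
Qed.

Lemma is_pd_mult (d : bool) (u v : R2 -> C) (z : R2) (l m : C) :
  is_pd d u z l -> is_pd d v z m ->
  is_pd d (fun w => u w * v w) z (l * v z + u z * m).
Proof.
  intros H1 H2; generalize (is_derive_Cmult _ _ _ _ _ H1 H2).
  now rewrite line_coord.
Qed.

Lemma is_pd_inv (d : bool) (u : R2 -> C) (z : R2) (l : C) :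
  u z <> RtoC 0 -> is_pd d u z l ->
  is_pd d (fun w => / u w) z (- l * (/ u z * / u z)).
Proof.
  intros Hz H; rewrite <- (line_coord d z) in Hz.
  generalize (is_derive_Cinv _ _ _ Hz H); now rewrite line_coord.
Qed.

Lemma is_pd_plus (d : bool) (u v : R2 -> C) (z : R2) (l m : C) :
  is_pd d u z l -> is_pd d v z m -> is_pd d (fun w => u w + v w) z (l + m).
Proof. apply (is_derive_plus (K := R_AbsRing) (V := C_R_NormedModule)). Qed.

Lemma is_pd_opp (d : bool) (u : R2 -> C) (z : R2) (l : C) :
  is_pd d u z l -> is_pd d (fun w => - u w) z (- l).
Proof. apply (is_derive_opp (K := R_AbsRing) (V := C_R_NormedModule)). Qed.

(** * The classes of continuously differentiable functions *)

Lemma continuous_C_iff (u : R2 -> C) (z : R2) :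
  continuous u z <->
  continuous (fun w => Re (u w)) z /\ continuous (fun w => Im (u w)) z.
Proof.
  split.
  - intros H; split.
    + apply (continuous_comp u fst z H). apply continuous_fst.
    + apply (continuous_comp u snd z H). apply continuous_snd.
  - intros [H1 H2].
    apply (continuous_ext (fun w => (Re (u w), Im (u w)))).
    { intros w; now destruct (u w). }
    apply (continuous_comp_2 (fun w => Re (u w)) (fun w => Im (u w))
      (fun a b => (a, b)) z H1 H2).
    apply (continuous_ext (fun x => x)); [now intros []|apply continuous_id].
Qed.

Lemma continuous_Cplus (u v : R2 -> C) (z : R2) :
  continuous u z -> continuous v z -> continuous (fun w => u w + v w) z.
Proof.
  rewrite !continuous_C_iff; intros [u1 u2] [v1 v2]; split.
  - now apply (continuous_plus (fun w => Re (u w)) (fun w => Re (v w))).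
  - now apply (continuous_plus (fun w => Im (u w)) (fun w => Im (v w))).
Qed.

Lemma continuous_Copp (u : R2 -> C) (z : R2) :
  continuous u z -> continuous (fun w => - u w) z.
Proof.
  rewrite !continuous_C_iff; intros [u1 u2]; split.
  - now apply (continuous_opp (fun w => Re (u w))).
  - now apply (continuous_opp (fun w => Im (u w))).
Qed.

Lemma continuous_Cmult (u v : R2 -> C) (z : R2) :
  continuous u z -> continuous v z -> continuous (fun w => u w * v w) z.
Proof.
  rewrite !continuous_C_iff; intros [u1 u2] [v1 v2]; split.
  - apply (continuous_minus (fun w => mult (Re (u w)) (Re (v w)))
      (fun w => mult (Im (u w)) (Im (v w)))).
    + now apply (continuous_mult (fun w => Re (u w)) (fun w => Re (v w))).
    + now apply (continuous_mult (fun w => Im (u w)) (fun w => Im (v w))).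
  - apply (continuous_plus (fun w => mult (Re (u w)) (Im (v w)))
      (fun w => mult (Im (u w)) (Re (v w)))).
    + now apply (continuous_mult (fun w => Re (u w)) (fun w => Im (v w))).
    + now apply (continuous_mult (fun w => Im (u w)) (fun w => Re (v w))).
Qed.

Lemma continuous_Cinv (u : R2 -> C) (z : R2) :
  u z <> 0 -> continuous u z -> continuous (fun w => / u w) z.
Proof.
  intros Hz; apply Cnorm2_neq_0 in Hz.
  rewrite !continuous_C_iff; intros [u1 u2].
  assert (N : continuous (fun w => / (Re (u w) ^ 2 + Im (u w) ^ 2))%R z).
  { apply (continuous_comp (fun w => (Re (u w) ^ 2 + Im (u w) ^ 2)%R) Rinv z).
    - apply (continuous_ext (fun w => plus (mult (Re (u w)) (Re (u w)))
        (mult (Im (u w)) (Im (u w))))).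
      { intros w; unfold plus, mult; simpl; ring. }
      apply (continuous_plus (fun w => mult (Re (u w)) (Re (u w)))
        (fun w => mult (Im (u w)) (Im (u w)))).
      + now apply (continuous_mult (fun w => Re (u w)) (fun w => Re (u w))).
      + now apply (continuous_mult (fun w => Im (u w)) (fun w => Im (u w))).
    - apply (continuous_Rinv_comp (fun x => x)); [apply continuous_id|].
      exact Hz. }
  split.
  - now apply (continuous_mult (fun w => Re (u w))
      (fun w => / (Re (u w) ^ 2 + Im (u w) ^ 2))%R).
  - apply (continuous_mult (fun w => (- Im (u w))%R)
      (fun w => / (Re (u w) ^ 2 + Im (u w) ^ 2))%R); [|assumption].
    now apply (continuous_opp (fun w => Im (u w))).
Qed.

Lemma continuous_ext_on (U : R2 -> Prop) (u v : R2 -> C) z :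
  open U -> U z -> (forall w, U w -> u w = v w) ->
  continuous u z -> continuous v z.
Proof.
  intros HU Hz E; apply continuous_ext_loc.
  apply (filter_imp U); [exact E|now apply HU].
Qed.

(** The recursive description of [Ck_on], with a single clause for the two
    directions and the derivatives named. *)
Lemma Ck_on_S_iff (n : nat) (U : R2 -> Prop) (u : R2 -> C) :
  Ck_on (S n) U u <->
  (forall z, U z -> continuous u z) /\
  (forall d z, U z -> is_pd d u z (pd d u z)) /\
  (forall d, Ck_on n U (pd d u)).
Proof.
  split.
  - intros (H1 & H2 & H3 & H4); split; [exact H1|split].
    + intros d z Hz; apply is_pd_pd.
      destruct (H2 z Hz); now destruct d.
    + now intros [].
  - intros (H1 & H2 & H3); split; [exact H1|split; [|split]].
    + intros z Hz; split.
      * exists (pd true u z); exact (H2 true z Hz).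
      * exists (pd false u z); exact (H2 false z Hz).
    + exact (H3 true).
    + exact (H3 false).
Qed.

Lemma Ck_on_continuous (n : nat) (U : R2 -> Prop) (u : R2 -> C) (z : R2) :
  Ck_on n U u -> U z -> continuous u z.
Proof. destruct n; intros [H _]; exact (H z). Qed.

Lemma Ck_on_is_pd (n : nat) (U : R2 -> Prop) (u : R2 -> C) (d : bool)
    (z : R2) :
  Ck_on (S n) U u -> U z -> is_pd d u z (pd d u z).
Proof. rewrite Ck_on_S_iff; intros (_ & H & _); exact (H d z). Qed.

Lemma Ck_on_pd (n : nat) (U : R2 -> Prop) (u : R2 -> C) (d : bool) :
  Ck_on (S n) U u -> Ck_on n U (pd d u).
Proof. rewrite Ck_on_S_iff; intros (_ & _ & H); exact (H d). Qed.

Lemma Ck_on_pred (n : nat) : forall (U : R2 -> Prop) (u : R2 -> C),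
  Ck_on (S n) U u -> Ck_on n U u.
Proof.
  induction n as [|n IH]; intros U u H.
  - split; [intros z Hz; exact (Ck_on_continuous _ _ _ _ H Hz)|exact I].
  - rewrite Ck_on_S_iff in H |- *; destruct H as (H1 & H2 & H3).
    split; [exact H1|split; [exact H2|]]. intros d; apply IH, H3.
Qed.

Lemma Ck_on_ext (n : nat) : forall (U : R2 -> Prop) (u v : R2 -> C),
  open U -> (forall w, U w -> u w = v w) ->
  Ck_on n U u -> Ck_on n U v.
Proof.
  induction n as [|n IH]; intros U u v HU E H.
  - split; [|exact I]; intros z Hz.
    apply (continuous_ext_on U u); trivial; now apply H.
  - rewrite Ck_on_S_iff in H |- *; destruct H as (H1 & H2 & H3).
    split; [|split].
    + intros z Hz; apply (continuous_ext_on U u); auto.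
    + intros d z Hz; rewrite <- (pd_ext d U u v z); auto.
      apply (is_pd_ext d U u); auto.
    + intros d; apply (IH U (pd d u)); trivial.
      intros w Hw; now apply (pd_ext d U).
Qed.

Lemma Ck_on_plus (n : nat) : forall (U : R2 -> Prop) (u v : R2 -> C),
  open U ->
  Ck_on n U u -> Ck_on n U v -> Ck_on n U (fun w => u w + v w).
Proof.
  induction n as [|n IH]; intros U u v HU Hu Hv.
  - split; [|exact I]; intros z Hz.
    apply continuous_Cplus; eapply Ck_on_continuous; eassumption.
  - assert (D : forall d z, U z ->
      is_pd d (fun w => u w + v w) z (pd d u z + pd d v z)).
    { intros d z Hz; apply is_pd_plus; eapply Ck_on_is_pd; eassumption. }
    rewrite Ck_on_S_iff; split; [|split].
    + intros z Hz; apply continuous_Cplus; eapply Ck_on_continuous; eassumption.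
    + intros d z Hz; apply is_pd_pd; eexists; now apply D.
    + intros d; apply (Ck_on_ext n U (fun w => pd d u w + pd d v w)); trivial.
      * intros w Hw; symmetry; now apply is_pd_unique, D.
      * apply IH; trivial; now apply Ck_on_pd.
Qed.

Lemma Ck_on_opp (n : nat) : forall (U : R2 -> Prop) (u : R2 -> C),
  open U ->
  Ck_on n U u -> Ck_on n U (fun w => - u w).
Proof.
  induction n as [|n IH]; intros U u HU Hu.
  - split; [|exact I]; intros z Hz.
    apply continuous_Copp; eapply Ck_on_continuous; eassumption.
  - assert (D : forall d z, U z -> is_pd d (fun w => - u w) z (- pd d u z)).
    { intros d z Hz; apply is_pd_opp; eapply Ck_on_is_pd; eassumption. }
    rewrite Ck_on_S_iff; split; [|split].
    + intros z Hz; apply continuous_Copp; eapply Ck_on_continuous; eassumption.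
    + intros d z Hz; apply is_pd_pd; eexists; now apply D.
    + intros d; apply (Ck_on_ext n U (fun w => - pd d u w)); trivial.
      * intros w Hw; symmetry; now apply is_pd_unique, D.
      * apply IH; trivial; now apply Ck_on_pd.
Qed.

Lemma Ck_on_mult (n : nat) : forall (U : R2 -> Prop) (u v : R2 -> C),
  open U ->
  Ck_on n U u -> Ck_on n U v -> Ck_on n U (fun w => u w * v w).
Proof.
  induction n as [|n IH]; intros U u v HU Hu Hv.
  - split; [|exact I]; intros z Hz.
    apply continuous_Cmult; eapply Ck_on_continuous; eassumption.
  - assert (D : forall d z, U z ->
      is_pd d (fun w => u w * v w) z (pd d u z * v z + u z * pd d v z)).
    { intros d z Hz; apply is_pd_mult; eapply Ck_on_is_pd; eassumption. }
    rewrite Ck_on_S_iff; split; [|split].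
    + intros z Hz; apply continuous_Cmult; eapply Ck_on_continuous; eassumption.
    + intros d z Hz; apply is_pd_pd; eexists; now apply D.
    + intros d.
      apply (Ck_on_ext n U (fun w => pd d u w * v w + u w * pd d v w)); trivial.
      * intros w Hw; symmetry; now apply is_pd_unique, D.
      * apply Ck_on_plus; trivial; apply IH; trivial;
          try now apply Ck_on_pd.
        all: now apply Ck_on_pred.
Qed.

Lemma Ck_on_inv (n : nat) : forall (U : R2 -> Prop) (u : R2 -> C),
  open U -> (forall z, U z -> u z <> 0) ->
  Ck_on n U u -> Ck_on n U (fun w => / u w).
Proof.
  induction n as [|n IH]; intros U u HU H0 Hu.
  - split; [|exact I]; intros z Hz.
    apply continuous_Cinv; auto; eapply Ck_on_continuous; eassumption.
  - assert (D : forall d z, U z ->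
      is_pd d (fun w => / u w) z (- pd d u z * (/ u z * / u z))).
    { intros d z Hz; apply is_pd_inv; auto; eapply Ck_on_is_pd; eassumption. }
    assert (Hi : Ck_on n U (fun w => / u w)).
    { apply IH; trivial; now apply Ck_on_pred. }
    rewrite Ck_on_S_iff; split; [|split].
    + intros z Hz; apply continuous_Cinv; auto;
        eapply Ck_on_continuous; eassumption.
    + intros d z Hz; apply is_pd_pd; eexists; now apply D.
    + intros d.
      apply (Ck_on_ext n U (fun w => - pd d u w * (/ u w * / u w))); trivial.
      * intros w Hw; symmetry; now apply is_pd_unique, D.
      * apply Ck_on_mult; trivial; [|now apply Ck_on_mult].
        apply Ck_on_opp; trivial; now apply Ck_on_pd.
Qed.

(** Schwarz's theorem, transferred to complex values through the real and
    imaginary parts. *)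
Lemma dx_dy_comm (U : R2 -> Prop) (u : R2 -> C) (z : R2) :
  open U -> Ck_on 2 U u -> U z -> dx (dy u) z = dy (dx u) z.
Proof.
  intros HU Hu Hz.
  assert (D1 : forall d w, U w -> is_pd d u w (pd d u w)).
  { intros d w Hw; now apply (Ck_on_is_pd 1 U). }
  assert (D2 : forall d e w, U w -> is_pd d (pd e u) w (pd d (pd e u) w)).
  { intros d e w Hw; apply (Ck_on_is_pd 0 U); trivial; now apply Ck_on_pd. }
  assert (D3 : forall d e, continuous (pd d (pd e u)) z).
  { intros d e; apply (Ck_on_continuous 0 U); trivial; now do 2 apply Ck_on_pd. }
  destruct z as [x y].
  apply injective_projections;
    [apply (Schwarz (fun a b => Re (u (a, b))) x y)
    |apply (Schwarz (fun a b => Im (u (a, b))) x y)].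
  1, 4: apply locally_2d_locally; apply (filter_imp U); [|now apply HU].
  1, 2: intros [a b] Hw;
    destruct (proj1 (is_derive_C_iff _ _ _) (D1 true _ Hw));
    destruct (proj1 (is_derive_C_iff _ _ _) (D1 false _ Hw));
    destruct (proj1 (is_derive_C_iff _ _ _) (D2 false true _ Hw));
    destruct (proj1 (is_derive_C_iff _ _ _) (D2 true false _ Hw));
    repeat split; eexists; eassumption.
  all: apply continuity_2d_pt_filterlim.
  - exact (proj1 (proj1 (continuous_C_iff _ _) (D3 true false))).
  - exact (proj1 (proj1 (continuous_C_iff _ _) (D3 false true))).
  - exact (proj2 (proj1 (continuous_C_iff _ _) (D3 true false))).
  - exact (proj2 (proj1 (continuous_C_iff _ _) (D3 false true))).
Qed.

(** * Factorization of the operator *)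

Lemma div_vscal_grad (a u : R2 -> C) (z : R2) :
  div (fun w => vscal (a w) (grad u w)) z =
  pd true (fun w => a w * pd true u w) z
  + pd false (fun w => a w * pd false u w) z.
Proof. reflexivity. Qed.

Lemma div_vscal_grad_ext (U : R2 -> Prop) (a u v : R2 -> C) (z : R2) :
  open U -> U z -> (forall w, U w -> u w = v w) ->
  div (fun w => vscal (a w) (grad u w)) z =
  div (fun w => vscal (a w) (grad v w)) z.
Proof.
  intros HU Hz E; rewrite !div_vscal_grad; f_equal; apply (pd_ext _ U); trivial;
    intros w Hw; now rewrite (pd_ext _ U u v).
Qed.

(** The contribution of one direction to [div_grad_mult]. *)
Lemma pd_flux_mult (d : bool) (U : R2 -> Prop) (a w phi : R2 -> C) (z : R2) :
  open U -> Ck_on 1 U a -> Ck_on 2 U w -> Ck_on 2 U phi -> U z ->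
  w z * pd d (fun t => a t * pd d (fun r => w r * phi r) t) z =
  phi z * (w z * pd d (fun t => a t * pd d w t) z)
  + pd d (fun t => a t * (w t * w t) * pd d phi t) z.
Proof.
  intros HU Ha Hw Hphi Hz.
  assert (a1 := Ck_on_is_pd _ _ _ d z Ha Hz).
  assert (w1 := Ck_on_is_pd _ _ _ d z Hw Hz).
  assert (p1 := Ck_on_is_pd _ _ _ d z Hphi Hz).
  assert (w2 := Ck_on_is_pd _ _ _ d z (Ck_on_pd _ _ _ d Hw) Hz).
  assert (p2 := Ck_on_is_pd _ _ _ d z (Ck_on_pd _ _ _ d Hphi) Hz).
  rewrite (pd_ext d U (fun t => a t * pd d (fun r => w r * phi r) t)
    (fun t => a t * (pd d w t * phi t + w t * pd d phi t)) z HU Hz).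
  2:{ intros t Ht; f_equal; apply is_pd_unique, is_pd_mult;
      eapply Ck_on_is_pd; eassumption. }
  rewrite (is_pd_unique _ _ _ _ (is_pd_mult _ _ _ _ _ _ a1
    (is_pd_plus _ _ _ _ _ _ (is_pd_mult _ _ _ _ _ _ w2 p1)
      (is_pd_mult _ _ _ _ _ _ w1 p2)))).
  rewrite (is_pd_unique _ _ _ _ (is_pd_mult _ _ _ _ _ _ a1 w2)).
  rewrite (is_pd_unique _ _ _ _ (is_pd_mult _ _ _ _ _ _
    (is_pd_mult _ _ _ _ _ _ a1 (is_pd_mult _ _ _ _ _ _ w1 w1)) p2)).
  ring.
Qed.

(** Multiplication by [w] reduces [div a grad], up to the potential generated by
    [w] itself, to the pure divergence operator with coefficient [a w^2]. *)
Lemma div_grad_mult (U : R2 -> Prop) (a w phi : R2 -> C) (z : R2) :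
  open U -> Ck_on 1 U a -> Ck_on 2 U w -> Ck_on 2 U phi -> U z ->
  w z * div (fun t => vscal (a t) (grad (fun r => w r * phi r) t)) z =
  phi z * (w z * div (fun t => vscal (a t) (grad w t)) z)
  + div (fun t => vscal (a t * (w t * w t)) (grad phi t)) z.
Proof.
  intros HU Ha Hw Hphi Hz; rewrite !div_vscal_grad, Cmult_plus_distr_l.
  rewrite !(pd_flux_mult _ U) by assumption; ring.
Qed.

(** The contribution of one direction to [div_grad_inv]. *)
Lemma pd_flux_inv (d : bool) (U : R2 -> Prop) (p w : R2 -> C) (z : R2) :
  open U -> Ck_on 1 U p -> (forall t, U t -> p t <> 0) ->
  Ck_on 2 U w -> (forall t, U t -> w t <> 0) -> U z ->
  w z * pd d (fun t => 1 / p t * pd d (fun r => / w r) t) z =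
  1 / p z * (- pd d (fun t => p t * pd d w t) z / (p z * w z)
    + 2 * ((/ p z * pd d p z) * (/ w z * pd d w z))
    + 2 * ((/ w z * pd d w z) * (/ w z * pd d w z))).
Proof.
  intros HU Hp p0 Hw w0 Hz.
  assert (p1 := Ck_on_is_pd _ _ _ d z Hp Hz).
  assert (w1 := Ck_on_is_pd _ _ _ d z Hw Hz).
  assert (w2 := Ck_on_is_pd _ _ _ d z (Ck_on_pd _ _ _ d Hw) Hz).
  assert (ip := is_pd_inv _ _ _ _ (p0 z Hz) p1).
  assert (iw := is_pd_inv _ _ _ _ (w0 z Hz) w1).
  rewrite (pd_ext d U _ (fun t => / p t * (- pd d w t * (/ w t * / w t))) z HU Hz).
  2:{ intros t Ht; unfold Cdiv; rewrite Cmult_1_l; f_equal.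
      apply is_pd_unique, is_pd_inv; auto; eapply Ck_on_is_pd; eassumption. }
  rewrite (is_pd_unique _ _ _ _ (is_pd_mult _ _ _ _ _ _ ip
    (is_pd_mult _ _ _ _ _ _ (is_pd_opp _ _ _ _ w2)
      (is_pd_mult _ _ _ _ _ _ iw iw)))).
  rewrite (is_pd_unique _ _ _ _ (is_pd_mult _ _ _ _ _ _ p1 w2)).
  field; split; auto.
Qed.

(** The reciprocal of a nonvanishing solution [w] of the equation with
    coefficients [p] and [q] solves the one with coefficients [1 / p] and [q1]. *)
Lemma div_grad_inv (U : R2 -> Prop) (p q w : R2 -> C) (z : R2) :
  open U -> Ck_on 1 U p -> (forall t, U t -> p t <> 0) ->
  is_solution U p q w -> (forall t, U t -> w t <> 0) -> U z ->
  w z * div (fun t => vscal (1 / p t) (grad (fun r => / w r) t)) z =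
  - q1 p q w z.
Proof.
  intros HU Hp p0 [Hw Lw] w0 Hz.
  rewrite div_vscal_grad, Cmult_plus_distr_l.
  rewrite !(pd_flux_inv _ U) by assumption.
  specialize (Lw z Hz); unfold div_grad_op in Lw; rewrite div_vscal_grad in Lw.
  assert (E : pd true (fun t => p t * pd true w t) z =
    - (q z * w z) - pd false (fun t => p t * pd false w t) z).
  { transitivity (pd true (fun t => p t * pd true w t) z - 0); [ring|].
    rewrite <- Lw; ring. }
  rewrite E; unfold q1, dot, vscal, grad; simpl.
  field; split; auto.
Qed.

(** If [a grad phi] is the rotated gradient of a stream function [psi], then it
    is divergence free. *)
Lemma div_grad_stream (U : R2 -> Prop) (a phi psi : R2 -> C) (z : R2) :
  open U -> Ck_on 2 U psi ->
  (forall t, U t -> a t * pd true phi t = pd false psi t) ->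
  (forall t, U t -> a t * pd false phi t = - pd true psi t) -> U z ->
  div (fun t => vscal (a t) (grad phi t)) z = 0.
Proof.
  intros HU Hpsi E1 E2 Hz; rewrite div_vscal_grad.
  rewrite (pd_ext true U _ _ z HU Hz E1), (pd_ext false U _ _ z HU Hz E2).
  rewrite (is_pd_unique _ _ _ _ (is_pd_opp _ _ _ _
    (Ck_on_is_pd _ _ _ false z (Ck_on_pd _ _ _ true Hpsi) Hz))).
  simpl; rewrite (dx_dy_comm U psi z HU Hpsi Hz); ring.
Qed.

(** * The Vekua equation *)

(** The scalar and vector parts of the Vekua equation. *)
Lemma vekua_components (f : R2 -> C) (W : R2 -> bicomplex) (z : R2) :
  Dzbar W z =
    Bmult (Bmult (Dzbar (fun w => B_of_C (f w)) z) (B_of_C (/ f z)))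
      (Bconj (W z)) ->
  pd true (fun w => sc (W w)) z - pd false (fun w => vec (W w)) z =
    (pd true f z * sc (W z) + pd false f z * vec (W z)) * / f z /\
  pd true (fun w => vec (W w)) z + pd false (fun w => sc (W w)) z =
    (pd false f z * sc (W z) - pd true f z * vec (W z)) * / f z.
Proof.
  assert (D0 : forall d, pd d (fun _ => 0) z = 0).
  { intros d; apply is_pd_unique.
    apply (is_derive_const (K := R_AbsRing) (V := C_R_NormedModule)). }
  intros H.
  assert (H1 := f_equal sc H); assert (H2 := f_equal vec H).
  unfold Dzbar, Bmult, Bplus, B_of_C, Bk, Bconj, Bdx, Bdy in H1, H2.
  cbn [sc vec] in H1, H2.
  change (dx (fun _ => 0) z) with (pd true (fun _ => 0) z) in H1, H2.
  change (dy (fun _ => 0) z) with (pd false (fun _ => 0) z) in H1, H2.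
  rewrite !D0 in H1, H2; change (fun w => f w) with f in H1, H2.
  assert (N : RtoC 2 <> 0) by (intros E; injection E; apply Rgt_not_eq, Rlt_0_2).
  cbn [pd]; clear H; revert H1 H2; generalize (/ f z); intros fi H1 H2.
  (* both sides of the equation carry the factor 1/2 of the operator [Dzbar] *)
  split.
  - match type of H1 with ?l = ?r => transitivity (2 * l);
      [field; exact N|rewrite H1; field; exact N] end.
  - match type of H2 with ?l = ?r => transitivity (2 * l);
      [field; exact N|rewrite H2; field; exact N] end.
Qed.


(** In terms of [phi] and [psi], the Vekua equation is a generalized
    Cauchy-Riemann system without terms of order zero. *)
Lemma vekua_system (U : R2 -> Prop) (f : R2 -> C) (W : R2 -> bicomplex)
    (z : R2) :
  Ck_on 1 U f -> (forall t, U t -> f t <> 0) ->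
  is_vekua_solution U f W -> U z ->
  let phi := fun t => / f t * sc (W t) in
  let psi := fun t => f t * vec (W t) in
  f z * f z * pd true phi z = pd false psi z /\
  f z * f z * pd false phi z = - pd true psi z.
Proof.
  intros Hf f0 (H1 & H2 & HW) Hz phi psi.
  destruct (vekua_components f W z (HW z Hz)) as [E1 E2].
  assert (P : forall d, pd d phi z =
    - pd d f z * (/ f z * / f z) * sc (W z) + / f z * pd d (fun t => sc (W t)) z).
  { intros d; apply is_pd_unique.
    apply (is_pd_mult d (fun t => / f t) (fun t => sc (W t))).
    - apply is_pd_inv; auto; eapply Ck_on_is_pd; eassumption.
    - eapply Ck_on_is_pd; eassumption. }
  assert (Q : forall d, pd d psi z =
    pd d f z * vec (W z) + f z * pd d (fun t => vec (W t)) z).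
  { intros d; apply is_pd_unique.
    apply (is_pd_mult d f (fun t => vec (W t))); eapply Ck_on_is_pd; eassumption. }
  rewrite !P, !Q; split.
  - transitivity (pd false f z * vec (W z) + f z * pd false (fun t => vec (W t)) z
      + f z * ((pd true (fun w => sc (W w)) z - pd false (fun w => vec (W w)) z)
        - (pd true f z * sc (W z) + pd false f z * vec (W z)) * / f z)).
    + field; repeat split; auto.
    + rewrite E1; ring.
  - transitivity (- (pd true f z * vec (W z) + f z * pd true (fun t => vec (W t)) z)
      + f z * ((pd true (fun w => vec (W w)) z + pd false (fun w => sc (W w)) z)
        - (pd false f z * sc (W z) - pd true f z * vec (W z)) * / f z)).
    + field; repeat split; auto.
    + rewrite E2; ring.
Qed.

(** * Solutions generated by the Vekua equation *)

(* s is the fixed twice continuously differentiable square root p^(1/2). *)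
Theorem theorem9 :
  forall (Omega : R2 -> Prop) (p q s u0 : R2 -> C) (W : R2 -> bicomplex),
    is_domain Omega ->
    Ck_on 2 Omega p ->
    (forall z, Omega z -> p z <> 0) ->
    Ck_on 2 Omega s ->
    (forall z, Omega z -> s z * s z = p z) ->
    is_solution Omega p q u0 ->
    (forall z, Omega z -> u0 z <> 0) ->
    is_vekua_solution Omega (fun z => s z * u0 z) W ->
    is_solution Omega p q (fun z => / s z * sc (W z)) /\
    is_solution Omega (fun z => 1 / p z) (q1 p q u0)
      (fun z => s z * vec (W z)).
Proof.
  intros Omega p q s u0 W [HO _] Hp p0 Hs Hsp Hsol u00 HW.
  assert (Hu0 := proj1 Hsol).
  assert (s0 : forall z, Omega z -> s z <> 0).
  { intros z Hz E; apply (p0 z Hz); rewrite <- (Hsp z Hz), E; ring. }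
  set (f := fun z => s z * u0 z) in *.
  assert (f0 : forall z, Omega z -> f z <> 0).
  { intros z Hz; apply Cmult_neq_0; auto. }
  assert (Hf : Ck_on 2 Omega f) by now apply Ck_on_mult.
  assert (ff : forall z, Omega z -> f z * f z = p z * (u0 z * u0 z)).
  { intros z Hz; unfold f; rewrite <- (Hsp z Hz); ring. }
  assert (HW1 := proj1 HW); assert (HW2 := proj1 (proj2 HW)).
  pose (phi := fun z => / f z * sc (W z)); pose (psi := fun z => f z * vec (W z)).
  assert (Hphi : Ck_on 2 Omega phi).
  { apply Ck_on_mult; trivial; now apply Ck_on_inv. }
  assert (Hpsi : Ck_on 2 Omega psi) by now apply Ck_on_mult.
  assert (E : forall z, Omega z -> f z * f z * pd true phi z = pd false psi z /\
    f z * f z * pd false phi z = - pd true psi z).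
  { intros z Hz; apply (vekua_system Omega); trivial; now apply Ck_on_pred. }
  split; split.
  - apply Ck_on_mult; trivial; now apply Ck_on_inv.
  - intros z Hz; unfold div_grad_op.
    rewrite (div_vscal_grad_ext Omega p _ (fun t => u0 t * phi t) z HO Hz).
    2:{ intros t Ht; unfold phi, f; field; repeat split; auto. }
    assert (D := div_grad_mult Omega p u0 phi z HO (Ck_on_pred _ _ _ Hp) Hu0 Hphi Hz).
    rewrite (div_grad_stream Omega (fun t => p t * (u0 t * u0 t)) phi psi z) in D;
      trivial.
    2, 3: intros t Ht; rewrite <- ff by trivial; now apply E.
    assert (L := proj2 Hsol z Hz); unfold div_grad_op in L.
    match goal with |- ?X + ?Y = _ =>
      transitivity (/ u0 z * (u0 z * X) + Y); [field; auto|] end.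
    rewrite D.
    transitivity (phi z *
      (div (fun w => vscal (p w) (grad u0 w)) z + q z * u0 z)).
    + unfold phi, f; field; repeat split; auto.
    + rewrite L; ring.
  - now apply Ck_on_mult.
  - assert (Hip : Ck_on 1 Omega (fun z => 1 / p z)).
    { apply (Ck_on_ext 1 Omega (fun z => / p z)); trivial.
      - intros z Hz; unfold Cdiv; ring.
      - apply Ck_on_inv; trivial; now apply Ck_on_pred. }
    assert (Hiu : Ck_on 2 Omega (fun z => / u0 z)) by now apply Ck_on_inv.
    (* for the inverse coefficient, the stream function of [psi] is [- phi] *)
    assert (Hopp : forall d t, Omega t -> pd d (fun r => - phi r) t = - pd d phi t).
    { intros d t Ht; now apply is_pd_unique, is_pd_opp, (Ck_on_is_pd 1 Omega). }
    intros z Hz; unfold div_grad_op.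
    rewrite (div_vscal_grad_ext Omega _ _ (fun t => / u0 t * psi t) z HO Hz).
    2:{ intros t Ht; unfold psi, f; field; repeat split; auto. }
    assert (D := div_grad_mult Omega _ _ psi z HO Hip Hiu Hpsi Hz); simpl in D.
    rewrite (div_grad_stream Omega _ psi (fun t => - phi t) z) in D; trivial.
    + assert (L := div_grad_inv Omega p q u0 z HO (Ck_on_pred _ _ _ Hp) p0 Hsol u00 Hz).
      match goal with |- ?X + ?Y = _ =>
        transitivity (u0 z * (/ u0 z * X) + Y); [field; auto|] end.
      rewrite D.
      transitivity (psi z * / u0 z *
        (u0 z * div (fun t => vscal (1 / p t) (grad (fun r => / u0 r) t)) z
         + q1 p q u0 z)).
      * unfold psi, f; field; repeat split; auto.
      * rewrite L; ring.
    + now apply Ck_on_opp.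
    + intros t Ht; destruct (E t Ht) as [_ E2].
      rewrite ff in E2 by trivial; rewrite Hopp by trivial.
      transitivity (- / (p t * (u0 t * u0 t)) * - pd true psi t);
        [field; repeat split; auto|].
      rewrite <- E2; field; repeat split; auto.
    + intros t Ht; destruct (E t Ht) as [E1 _].
      rewrite ff in E1 by trivial; rewrite Hopp, <- E1 by trivial.
      field; repeat split; auto.
Qed.
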